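(* Fix $d\ge2$ and let $$Z_n=\sum_{(v_1,\dots,v_d)\in E_n}q_n(v_1,\dots,v_d)\prod_{i=1}^dX_{v_i},\qquad n\ge1,$$ be a sequence of homogeneous sums of order $d$. Let $\mathcal G_n=(V_n,\mathcal E_n,w_n)$, $n\ge1$, be the associated weighted hypergraphs, assumed to be such that every vertex has strictly positive weighted degree, and let $0=\mu_1^{(n)}\le\mu_2^{(n)}\le\cdots\le\mu_{|V_n|}^{(n)}\leq 2$ be the eigenvalues of the normalized Laplacian of $\mathcal G_n$. If there exists $k\ge2$ such that $$\liminf_{n\to\infty}\mu_k^{(n)}>0,$$ then $\{Z_n\}$ is irreducible.
   Context: Setting: $\{V_n\}$ are nonempty finite sets with $|V_n|\to\infty$, $V=\bigcup_nV_n$, and $\{X_v:v\in V\}$ are i.i.d. standard normal random variables. The sets $E_n\subset V_n^d$ satisfy $|E_n|\to\infty$ and are symmetric (stable under permutations of the coordinates) and non-diagonal ($(v_1,\dots,v_d)\in E_n$ implies $v_i\ne v_j$ for $i\ne j$). The coefficients $q_n:E_n\to\mathbb R$ are symmetric (invariant under permutations of the arguments), nonzero on $E_n$, and satisfy $\|q_n\|^2:=\sum_{(v_1,\dots,v_d)\in E_n}q_n(v_1,\dots,v_d)^2\to\infty$. Associated hypergraph: $\mathcal E_n=\{\{v_1,\dots,v_d\}\subset V_n:(v_1,\dots,v_d)\in E_n\}$ and $w_n(\{v_1,\dots,v_d\})=q_n(v_1,\dots,v_d)^2$. Its adjacency matrix $A_n$, indexed by $V_n$, has zero diagonal and entries $A_n(u,v)=\sum_{e\in\mathcal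 E_n:\,u,v\in e}\frac{w_n(e)}{d-1}$ for $u\ne v$. The weighted degree of $v$ is $d(v)=\sum_{e\in\mathcal E_n:\,e\ni v}w_n(e)$, $D_n$ is the diagonal matrix of weighted degrees, and the normalized Laplacian is $\mathcal L_n=I-D_n^{-1/2}A_nD_n^{-1/2}$; eigenvalues are listed in nondecreasing order with multiplicity. Irreducibility: for $B\subset V_n$ put $\sigma_n^2(B)=d!\sum_{(v_1,\dots,v_d)\in E_n\cap B^d}q_n(v_1,\dots,v_d)^2$. The sequence $\{Z_n\}$ is reducible if for every $n$ there exist pairwise disjoint subsets $B_1,\dots,B_{m_n}\subset V_n$ (depending on $n$) such that, as $n\to\infty$: (i) $m_n\to\infty$; (ii) $\frac1{d!\|q_n\|^2}\sum_{i=1}^{m_n}\sigma_n^2(B_i)\to1$; (iii) $\frac1{d!\|q_n\|^2}\max_{i=1,\dots,m_n}\sigma_n^2(B_i)\to0$. It is irreducible if no such choice exists. *)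

(* Defs.v *)
From HB Require Import structures.
From mathcomp Require Import all_boot all_order all_algebra.
From mathcomp Require Import finmap.
From mathcomp Require Import all_classical all_reals all_analysis.
Set Implicit Arguments.
Unset Strict Implicit.
Unset Printing Implicit Defensive.
Import Order.TTheory GRing.Theory Num.Theory.
Import numFieldNormedType.Exports.
Local Open Scope fset_scope.
Local Open Scope classical_set_scope.
Local Open Scope ring_scope.

Section Coefficients.
Variables (R : realType) (d : nat) (T : finType).
Implicit Types (E : {set d.-tuple T}) (q : d.-tuple T -> R).

Definition symmetric_support E : Prop :=
  forall s t : d.-tuple T, perm_eq s t -> s \in E -> t \in E.

Definition non_diagonal E : Prop := forall t : d.-tuple T, t \in E -> uniq t.

(* q stands for a function on E: its values outside E are never used. *)
Definition symmetric_coef E q : Prop :=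
  forall s t : d.-tuple T, s \in E -> t \in E -> perm_eq s t -> q s = q t.

Definition nonzero_coef E q : Prop :=
  forall t : d.-tuple T, t \in E -> q t != 0.

Definition sqnorm_coef E q : R := \sum_(t in E) q t ^+ 2.

Definition sigma2 E q (B : {set T}) : R :=
  d`!%:R * \sum_(t in E | all (fun v => v \in B) t) q t ^+ 2.

Definition hyperedges E : {set {set T}} := [set [set v in t] | t : d.-tuple T in E].

(* When E and q are symmetric, the value does not depend on the chosen
   enumeration t of e; it is 0 if e is not a hyperedge. *)
Definition hweight E q (e : {set T}) : R :=
  if [pick t : d.-tuple T | (t \in E) && ([set v in t] == e)] is Some t
  then q t ^+ 2 else 0.

Definition wdegree E q (v : T) : R :=
  \sum_(e in hyperedges E | v \in e) hweight E q e.

(* Matrices indexed by T are indexed by 'I_#|T| through enum_val. *)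
Definition adjacency E q : 'M[R]_#|T| :=
  \matrix_(i, j) if i == j then 0 else
    \sum_(e in hyperedges E | (enum_val i \in e) && (enum_val j \in e))
      hweight E q e / (d%:R - 1).

Definition degree_inv_sqrt E q : 'M[R]_#|T| :=
  diag_mx (\row_i (Num.sqrt (wdegree E q (enum_val i)))^-1).

Definition normalized_laplacian E q : 'M[R]_#|T| :=
  1%:M - degree_inv_sqrt E q *m adjacency E q *m degree_inv_sqrt E q.

End Coefficients.

(* The roots of the characteristic polynomial, with multiplicity and in
   nondecreasing order; a symmetric real matrix has exactly one such list. *)
Definition ordered_eigenvalues (R : realType) (m : nat) (M : 'M[R]_m)
    (s : seq R) : Prop :=
  sorted <=%R s /\ char_poly M = \prod_(a <- s) ('X - a%:P).

Section RandomVariables.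
Context (R : realType) (dO : measure_display) (Omega : measurableType dO).
Variables (P : probability Omega R) (U : choiceType).
Implicit Types (V : set U) (X : U -> {RV P >-> R}).

Definition mutually_independent V X : Prop :=
  forall (J : {fset U}) (A : U -> set R),
    [set` J] `<=` V -> (forall v, measurable (A v)) ->
    P (\bigcap_(v in [set` J]) (X v @^-1` A v)) =
      (\prod_(v <- J) P (X v @^-1` A v))%E.

Definition iid_standard_normal V X : Prop :=
  mutually_independent V X /\
  forall v, V v -> forall A : set R, measurable A ->
    distribution P (X v) A = normal_prob 0 1 A.

(* The finite sets V_n are finite subsets of an arbitrary type U (they may
   overlap); only the X_v with v in their union are constrained. *)
Record homogeneous_sums (d : nat) := HomogeneousSums {
  hs_V : nat -> {fset U} ;
  hs_X : U -> {RV P >-> R} ;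
  hs_E : forall n, {set d.-tuple (hs_V n)} ;
  hs_q : forall n, d.-tuple (hs_V n) -> R ;
  hs_V_nonempty : forall n, hs_V n != fset0 ;
  hs_V_infty : #|` hs_V n| @[n --> \oo] --> \oo ;
  hs_X_iid : iid_standard_normal (\bigcup_n [set` hs_V n]) hs_X ;
  hs_E_infty : #|hs_E n| @[n --> \oo] --> \oo ;
  hs_E_sym : forall n, symmetric_support (hs_E n) ;
  hs_E_nondiag : forall n, non_diagonal (hs_E n) ;
  hs_q_sym : forall n, symmetric_coef (hs_E n) (@hs_q n) ;
  hs_q_neq0 : forall n, nonzero_coef (hs_E n) (@hs_q n) ;
  hs_q_infty : sqnorm_coef (hs_E n) (@hs_q n) @[n --> \oo] --> +oo ;
  hs_Z : nat -> Omega -> R ;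
  hs_ZE : forall n w, hs_Z n w =
    \sum_(t in hs_E n) hs_q t * \prod_(i < d) hs_X (val (tnth t i)) w
}.

Arguments hs_q {d} h n t.

Definition reducible (d : nat) (Z : homogeneous_sums d) : Prop :=
  exists (m : nat -> nat) (B : forall n, 'I_(m n) -> {set hs_V Z n}),
    let s2 n := sigma2 (hs_E Z n) (hs_q Z n) in
    let tot n := d`!%:R * sqnorm_coef (hs_E Z n) (hs_q Z n) in
    [/\ forall n (i j : 'I_(m n)), i != j -> [disjoint B n i & B n j]%B,
        m n @[n --> \oo] --> \oo,
        (tot n)^-1 * \sum_(i < m n) s2 n (B n i) @[n --> \oo] --> (1 : R) &
        (tot n)^-1 * \big[Num.max/0]_(i < m n) s2 n (B n i)
          @[n --> \oo] --> (0 : R)].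

Definition irreducible (d : nat) (Z : homogeneous_sums d) : Prop :=
  ~ reducible Z.

Definition hs_laplacian (d : nat) (Z : homogeneous_sums d) (n : nat) :
    'M[R]_#|{: hs_V Z n}| :=
  normalized_laplacian (hs_E Z n) (hs_q Z n).

End RandomVariables.

Arguments hs_q {R dO Omega P U d} h n t.

(* Main.v *)
Require Import Defs.
From HB Require Import structures.
From mathcomp Require Import all_boot all_order all_algebra.
From mathcomp Require Import spectral complex.
From mathcomp Require Import finmap.
From mathcomp Require Import all_classical all_reals all_analysis.
From mathcomp Require Import ring lra.
Import Order.TTheory GRing.Theory Num.Theory.
Import numFieldNormedType.Exports.
Local Open Scope ring_scope.

(** If the sequence were reducible, then for suitable large [n] there would be
    pairwise disjoint blocks [B_i] of vertices, each containing only a small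
    proportion of the total hyperedge weight, but together containing almost
    all of it.  As the blocks are small, they can be put into [k] groups, each
    of which carries at least a fraction [1/(4k)] of the weight
    ([exists_balanced_grouping]).

    A function on the vertices that is constant on each group and vanishes
    off the blocks has a small Rayleigh quotient.  Indeed, a hyperedge that
    lies inside one block sees a constant function and contributes no energy,
    so only the spilled hyperedges, those inside no block, matter, and their
    total weight is small; on the other hand the squared norm is bounded
    below by the weight of the groups.  Such functions form a [k]-dimensional
    space, and the Courant-Fischer principle ([kth_eigenvalue_le_rayleigh])
    bounds the [k]-th eigenvalue by
    [d / (d - 1) * spilled weight / weight of the lightest group]
    ([kth_eigenvalue_le_spill]).  This can be made smaller than any positive
    constant, which contradicts the positive limit inferior.

    The energy is computed edge by edge: with [x = D^(1/2) phi], the quadratic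
    form of the normalized Laplacian at [x] is the sum over hyperedges [e] of
    [w(e) (d sum_(e) phi^2 - (sum_(e) phi)^2) / (d - 1)]
    ([degree_scaled_laplacian]).  Sums over hyperedges and sums over tuples
    are exchanged through the fact that a hyperedge has exactly [d!] orderings
    ([sum_hyperedges]). *)

Set Implicit Arguments.
Unset Strict Implicit.
Unset Printing Implicit Defensive.

(** * Courant-Fischer bound on the k-th eigenvalue *)

Section CourantFischer.
Local Open Scope sesquilinear_scope.
Local Open Scope complex_scope.
Variable R : rcfType.
Local Notation toC := (real_complex R).

Lemma char_poly_invmx_conj (F : fieldType) n (P M : 'M[F]_n) :
  P \in unitmx -> char_poly (invmx P *m M *m P) = char_poly M.
Proof.
move=> uP; rewrite /char_poly.
have -> : char_poly_mx (invmx P *m M *m P) =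
    map_mx polyC (invmx P) *m char_poly_mx M *m map_mx polyC P.
  rewrite /char_poly_mx mulmxBr mulmxBl !map_mxM /=; congr (_ - _).
  by rewrite scalar_mxC -mulmxA -map_mxM mulVmx // map_mx1 mulmx1.
rewrite !det_mulmx mulrC mulrA -det_mulmx -map_mxM mulmxV //.
by rewrite map_mx1 det1 mul1r.
Qed.

(** The cross terms cancel since [N] is symmetric, so an inequality between
    real quadratic forms passes to complex vectors.  Hence a real test space
    can be compared with the eigenvectors of a complex diagonalization. *)
Lemma complex_quadratic_form n (N : 'M[R]_n) (u v : 'rV[R]_n) :
  N^T = N ->
  let x := map_mx toC u + 'i *: map_mx toC v in
  (x *m map_mx toC N *m x ^t*) 0 0 =
  toC ((u *m N *m u^T) 0 0 + (v *m N *m v^T) 0 0).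
Proof.
move=> sN x.
have xt : x ^t* = map_mx toC u^T - 'i *: map_mx toC v^T.
  by apply/matrixP => a b; rewrite !mxE; simpc.
have cross : v *m N *m u^T = u *m N *m v^T.
  apply: trmx_inj.
  rewrite [in LHS]trmx_mul trmxK trmx_mul sN mulmxA.
  by apply/matrixP => i j; rewrite !ord1 [RHS]mxE.
rewrite xt /x mulmxDl mulmxBr !mulmxDl -!scalemxAl -!scalemxAr -!map_mxM cross.
rewrite scalerA -expr2 sqr_i !mxE !rmorphD /=.
ring.
Qed.

(** The easy half of the Courant-Fischer principle.  Fewer than [k] eigenvalues
    are smaller than the [k]-th one, so the [k]-dimensional row space of [F],
    complexified, contains a nonzero vector orthogonal to the corresponding
    eigenvectors.  Its Rayleigh quotient is at least the [k]-th eigenvalue, and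
    at most [c]. *)
Lemma kth_eigenvalue_le_rayleigh n k (M : 'M[R]_n) (s : seq R) (c : R)
    (F : 'M[R]_(k, n)) :
  (0 < k)%N -> M^T = M -> sorted <=%R s ->
  char_poly M = \prod_(a <- s) ('X - a%:P) ->
  (forall a : 'rV_k, a != 0 -> 0 < ((a *m F) *m (a *m F)^T) 0 0) ->
  (forall a : 'rV_k, ((a *m F) *m M *m (a *m F)^T) 0 0 <=
     c * ((a *m F) *m (a *m F)^T) 0 0) ->
  nth 0 s k.-1 <= c.
Proof.
move=> k_gt0 sM srt chM Fpos Fle.
set l := nth 0 s k.-1.
set A := map_mx toC M.
have Asym : A \is symmetricmx.
  by apply/is_hermitianmxP; rewrite expr0 scale1r map_mx_id // /A map_trmx sM.
have Areal : A \is a realmx.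
  by apply/mxOverP => i j; rewrite mxE complex_real.
have /orthomx_spectralP := symmetric_normalmx Asym Areal.
set U := spectralmx A; set D := spectral_diag A => AE.
have Uu : U \is unitarymx by exact: spectral_unitarymx.
(* Both lists are the roots of the characteristic polynomial of A. *)
have Dp : perm_eq (map toC s) [seq D 0 i | i : 'I_n].
  apply: prod_XsubC_eq; rewrite big_image big_map -[LHS]map_prod_XsubC -chM.
  rewrite map_char_poly -/A AE char_poly_invmx_conj ?spectral_unit //.
  rewrite char_poly_trig ?diag_mx_is_trig //; apply: eq_bigr => i _.
  by rewrite !mxE eqxx.
pose J := [set i | D 0 i < toC l].
have ltJk : (#|J| < k)%N.
  have -> : #|J| = count (< l) s.
    rewrite (@eq_count _ _ (preim toC (< toC l))); last first.
      by move=> a; rewrite /= ltcR.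
    rewrite -count_map (permP Dp) count_map cardE size_filter enumT.
    by apply: eq_count => i; rewrite /= inE.
  rewrite -(prednK k_gt0) ltnS leqNgt; apply/negP => /(nth_count_lt 0 srt).
  by rewrite ltxx.
(* The kernel of G: coordinates of the vectors of the test space that are
   orthogonal to the eigenvectors indexed by J. *)
pose G := \matrix_(i < k, j < #|J|) (map_mx toC F *m U^t*) i (enum_val j).
have /rowV0Pn[a /sub_kermxP aG a0] : kermx G != 0.
  rewrite kermx_eq0 /row_free neq_ltn; apply/orP; left.
  exact: leq_ltn_trans (rank_leq_col G) ltJk.
pose b := map_mx (@complex.Re R) a; pose e := map_mx (@complex.Im R) a.
have aE : a = map_mx toC b + 'i *: map_mx toC e.
  by apply/rowP => i; rewrite !mxE -complexE.
have be0 : (b != 0) || (e != 0).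
  rewrite -negb_and; apply: contra a0 => /andP[/eqP b0 /eqP e0].
  by rewrite aE b0 e0 !map_mx0 scaler0 addr0.
pose x := a *m map_mx toC F.
have xE : x = map_mx toC (b *m F) + 'i *: map_mx toC (e *m F).
  by rewrite /x {1}aE mulmxDl -scalemxAl !map_mxM.
have [y yE] : {y | y = x *m U^t*} by exists (x *m U^t*).
have yJ i : D 0 i < toC l -> y 0 i = 0.
  move=> iJ; have iJ' : i \in J by rewrite inE.
  have /rowP/(_ (enum_rank_in iJ' i)) := aG.
  rewrite yE /x -mulmxA [RHS]mxE => <-; rewrite !(mxE _ _ 0).
  by apply: eq_bigr => j _; rewrite [G _ _]mxE enum_rankK_in.
have UU : U^t* *m U = 1%:M by rewrite -invmx_unitary // mulVmx // spectral_unit.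
have yt : y ^t* = U *m x ^t* by rewrite yE -[U in RHS]trmxCK -map_mxM -trmx_mul.
have xx : (x *m x ^t*) 0 0 = \sum_i `|y 0 i| ^+ 2.
  have -> : x *m x^t* = y *m y^t*.
    by rewrite yt {1}yE mulmxA -[_ *m _ *m U]mulmxA UU mulmx1.
  by rewrite mxE; apply: eq_bigr => i _; rewrite !mxE normCK.
have xAx : (x *m A *m x ^t*) 0 0 = \sum_i D 0 i * `|y 0 i| ^+ 2.
  have -> : x *m A *m x^t* = y *m diag_mx D *m y^t*.
    by rewrite AE invmx_unitary // yt yE !mulmxA.
  rewrite mxE; apply: eq_bigr => i _; rewrite mul_mx_diag !mxE normCK.
  by rewrite mulrCA mulrA.
have low : toC l * (x *m x ^t*) 0 0 <= (x *m A *m x ^t*) 0 0.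
  rewrite xx xAx mulr_sumr; apply: ler_sum => i _.
  have [/yJ ->|] := boolP (D 0 i < toC l).
    by rewrite normr0 expr0n !mulr0.
  rewrite -real_leNgt; last 2 first.
  - by rewrite complex_real.
  - have /mxOverP := hermitian_spectral_diag_real (realsym_hermsym Asym Areal).
    exact.
  by move=> ?; rewrite ler_wpM2r // exprn_ge0.
move: low; have := complex_quadratic_form (b *m F) (e *m F) sM.
have := complex_quadratic_form (b *m F) (e *m F) (trmx1 _ _).
rewrite /= -xE map_mx1 !mulmx1 -/A => -> ->; rewrite -rmorphM lecR => low.
have xx_gt0 : 0 < (b *m F *m (b *m F)^T) 0 0 + (e *m F *m (e *m F)^T) 0 0.
  have Fge0 (v : 'rV_k) : 0 <= (v *m F *m (v *m F)^T) 0 0.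
    have [->|v0] := eqVneq v 0; last exact: ltW (Fpos _ v0).
    by rewrite !mul0mx mxE.
  case/orP: be0 => [/Fpos b0|/Fpos e0]; [exact: ltr_wpDr|exact: ltr_wpDl].
rewrite -(ler_pM2r xx_gt0); apply: le_trans low _.
by rewrite mulrDr lerD.
Qed.

End CourantFischer.

(** * Grouping small quantities *)

(** Split off, one group at a time, a minimal set of indices whose sum reaches
    [c]: by minimality its sum exceeds [c] by at most one term, hence by at most
    [eps], so enough is left for the remaining groups.  The last group takes all
    the leftover indices, which makes [f] total. *)
Lemma exists_balanced_grouping (R : realDomainType) (I : finType) (x : I -> R)
    (c eps : R) (k : nat) :
  0 <= c -> 0 <= eps -> (forall i, x i <= eps) ->
  k.+1%:R * (c + eps) <= \sum_i x i ->
  exists f : I -> 'I_k.+1, forall j, c <= \sum_(i | f i == j) x i.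
Proof.
move=> c0 eps0 xe sumx.
suff: forall A : {set I}, k.+1%:R * (c + eps) <= \sum_(i in A) x i ->
    exists f : I -> 'I_k.+1, forall j, c <= \sum_(i in A | f i == j) x i.
  case/(_ [set: I]%SET) => [|f fP].
    by rewrite (eq_bigl predT) // => i; rewrite inE.
  exists f => j; apply: le_trans (fP j) _.
  by rewrite (eq_bigl (fun i => f i == j)) // => i; rewrite inE.
elim: k {sumx} => [|k IHk] A sumA.
  exists (fun=> ord0) => j; rewrite (eq_bigl (mem A)); last first.
    by move=> i; rewrite [j]ord1 eqxx andbT.
  by apply: le_trans sumA; rewrite mul1r lerDl.
have cA : c <= \sum_(i in A) x i.
  apply: le_trans sumA; apply: le_trans (_ : 1 * (c + eps) <= _).
    by rewrite mul1r lerDl.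
  by rewrite ler_wpM2r ?addr_ge0 // ler1n.
have [A' /minsetP[cA' minA'] A'A] :=
  @minset_exists _ (fun A : {set I} => c <= \sum_(i in A) x i) A cA.
have A'le : \sum_(i in A') x i <= c + eps.
  have [->|[i iA']] := set_0Vmem A'; first by rewrite big_set0 addr_ge0.
  rewrite (big_setD1 i) //= addrC lerD // leNgt; apply/negP => /ltW lt_c.
  have := minA' _ lt_c (subsetDl _ _) => /setP/(_ i).
  by rewrite !inE eqxx iA'.
have [g gP] : exists g : I -> 'I_k.+1,
    forall j, c <= \sum_(i in A :\: A' | g i == j) x i.
  apply: IHk; move: sumA; rewrite (big_setID A') /= (finset.setIidPr A'A).
  by rewrite -[k.+2]add1n natrD mulrDl mul1r; lra.
exists (fun i => if i \in A' then ord0 else lift ord0 (g i)) => j.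
have [{}j ->|->] := unliftP ord0 j.
  apply: le_trans (gP j) _; rewrite le_eqVlt; apply/orP; left; apply/eqP.
  apply: eq_bigl => i; rewrite !inE.
  by case: (i \in A'); rewrite /= ?andbF // (inj_eq lift_inj).
rewrite (eq_bigl (mem A')) // => i /=.
have [iA'|_] := boolP (i \in A'); first by rewrite (fintype.subsetP A'A).
by rewrite andbF.
Qed.

(** * Sums over hyperedges *)

Section Hypergraph.
Variables (R : realType) (d : nat) (T : finType).
Variables (E : {set d.-tuple T}) (q : d.-tuple T -> R).
Hypotheses (Esym : symmetric_support E) (End : non_diagonal E).
Hypothesis (qsym : symmetric_coef E q).

Local Notation H := (hyperedges E).
Local Notation w := (hweight E q).

Lemma card_hyperedge e : e \in H -> #|e| = d.
Proof.
case/imsetP => t tE ->; rewrite cardsE.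
by have /card_uniqP -> := End tE; rewrite size_tuple.
Qed.

(** By symmetry of [E], the orderings of the hyperedge of [t0] in [E] are all the
    duplicate-free [d]-tuples of elements of a [d]-element set. *)
Lemma card_orderings (t0 : d.-tuple T) : t0 \in E ->
  #|[pred t : d.-tuple T | (t \in E) && ([set v in t] == [set v in t0])]|
    = d`!.
Proof.
move=> t0E; have := card_uniq_tuples d (mem [set v in t0]).
rewrite (card_hyperedge (imset_f _ t0E)) ffactnn => <-.
rewrite cardsE; apply: eq_card => t; rewrite !inE.
apply/andP/andP => [[tE /eqP tt0]|[/allP tt0 ut]].
  by split; [apply/allP => v vt; rewrite /= -tt0 inE | exact: End].
have sub_t : {subset t <= t0} by move=> v /tt0; rewrite /= inE.
have [|_ tEt0] := uniq_min_size ut sub_t; first by rewrite !size_tuple.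
split; last by apply/eqP/setP => v; rewrite !inE tEt0.
by apply: (Esym _ t0E); rewrite perm_sym; apply: uniq_perm (End t0E) tEt0.
Qed.

Lemma hweight_support (t : d.-tuple T) : t \in E -> w [set v in t] = q t ^+ 2.
Proof.
move=> tE; rewrite /hweight; case: pickP => [t' /andP[t'E /eqP tt']|/(_ t)].
  congr (_ ^+ 2); apply: qsym => //; apply: uniq_perm => [||v]; try exact: End.
  by have /setP/(_ v) := tt'; rewrite !inE.
by rewrite tE eqxx.
Qed.

Lemma sum_hyperedges (g : {set T} -> R) :
  d`!%:R * (\sum_(e in H) w e * g e) = \sum_(t in E) q t ^+ 2 * g [set v in t].
Proof.
rewrite (partition_big_imset (fun t : d.-tuple T => [set v in t])) /= mulr_sumr.
apply: eq_bigr => _ /imsetP[t0 t0E ->].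
rewrite (eq_bigr (fun=> q t0 ^+ 2 * g [set v in t0])); last first.
  by move=> t /andP[tE /eqP tt0]; rewrite -!hweight_support // tt0.
by rewrite sumr_const card_orderings // hweight_support // mulr_natl.
Qed.

Lemma sum_wdegree (g : T -> R) :
  \sum_v wdegree E q v * g v = \sum_(e in H) w e * \sum_(v in e) g v.
Proof.
under eq_bigr do rewrite mulr_suml.
rewrite (exchange_big_dep (mem H)) /=; last by move=> ? ? _ /andP[].
apply: eq_bigr => e eH; rewrite mulr_sumr; apply: eq_bigl => v.
by rewrite eH.
Qed.

End Hypergraph.

(** * The quadratic form of the normalized Laplacian *)

Section Laplacian.
Variables (R : realType) (d : nat) (T : finType).
Variables (E : {set d.-tuple T}) (q : d.-tuple T -> R).
Hypothesis d_ge2 : (2 <= d)%N.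
Local Notation H := (hyperedges E).
Local Notation w := (hweight E q).
Local Notation deg := (wdegree E q).
Hypothesis deg_gt0 : forall v, 0 < deg v.

(** The vector [D^(1/2) phi], which turns the normalized Laplacian into the
    combinatorial one. *)
Definition degree_scaled (phi : T -> R) : 'rV[R]_#|T| :=
  \row_i (Num.sqrt (deg (enum_val i)) * phi (enum_val i)).

Lemma sum_enum_val (g : T -> R) : \sum_(i < #|T|) g (enum_val i) = \sum_v g v.
Proof. by symmetry; apply: (big_enum_val g). Qed.

Lemma normalized_laplacian_sym :
  (normalized_laplacian E q)^T = normalized_laplacian E q.
Proof.
rewrite /normalized_laplacian linearB /= trmx1 !trmx_mul !tr_diag_mx mulmxA.
congr (_ - _ *m _ *m _); apply/matrixP => i j; rewrite !mxE eq_sym.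
by case: eqP => // _; apply: eq_bigl => e; congr (_ && _); exact: andbC.
Qed.

Lemma degree_scaled_sqnorm phi :
  (degree_scaled phi *m (degree_scaled phi)^T) 0 0 =
  \sum_(e in H) w e * \sum_(v in e) phi v ^+ 2.
Proof.
rewrite mxE -sum_wdegree -sum_enum_val; apply: eq_bigr => i _.
by rewrite !mxE -expr2 exprMn sqr_sqrtr // ltW.
Qed.

(** Filling the zero diagonal of the adjacency matrix with [deg / (d - 1)] gives a
    matrix [K] whose quadratic form is a sum over hyperedges of squares; what
    was added on the diagonal accounts for the factor [d] in front of
    [sum phi^2]: [1 + 1 / (d - 1) = d / (d - 1)].  The summand vanishes when
    [phi] is constant on [e]. *)
Lemma degree_scaled_laplacian phi :
  (degree_scaled phi *m normalized_laplacian E q *m (degree_scaled phi)^T) 0 0 =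
  \sum_(e in H) w e *
    ((d%:R * \sum_(v in e) phi v ^+ 2 - (\sum_(v in e) phi v) ^+ 2)
      / (d%:R - 1)).
Proof.
have d1 : d%:R - 1 != 0 :> R.
  by rewrite subr_eq0 -[1]/(1%:R) eqr_nat neq_ltn d_ge2 orbT.
pose p : 'rV[R]_#|T| := \row_i phi (enum_val i).
have scaleE : degree_scaled phi *m degree_inv_sqrt E q = p.
  apply/rowP => i; rewrite mul_mx_diag !mxE mulrAC mulfV ?mul1r //.
  by rewrite gt_eqF // sqrtr_gt0.
have scaleE' : degree_inv_sqrt E q *m (degree_scaled phi)^T = p^T.
  by rewrite -scaleE trmx_mul tr_diag_mx.
pose m := d%:R - 1 : R.
pose K : 'M[R]_#|T| := \matrix_(i, j)
  \sum_(e in H | (enum_val i \in e) && (enum_val j \in e)) w e / m.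
have adjE : adjacency E q = K - diag_mx (\row_i (deg (enum_val i) / m)).
  apply/matrixP => i j; rewrite !mxE; case: eqP => [->|_].
    rewrite mulr1n /wdegree mulr_suml; apply/esym/eqP.
    by rewrite subr_eq0; apply/eqP/eq_bigl => e; rewrite andbb.
  by rewrite subr0.
have pKp : (p *m K *m p^T) 0 0 =
    \sum_(e in H) w e / m * (\sum_(v in e) phi v) ^+ 2.
  transitivity (\sum_u \sum_v \sum_(e in H | (u \in e) && (v \in e))
      w e / m * (phi u * phi v)).
    rewrite exchange_big mxE -sum_enum_val; apply: eq_bigr => j _ /=.
    rewrite !mxE mulr_suml -sum_enum_val; apply: eq_bigr => i _.
    by rewrite !mxE -mulrA mulrCA mulr_suml.
  transitivity (\sum_u \sum_(e in H | u \in e) \sum_(v in e)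
      w e / m * (phi u * phi v)).
    apply: eq_bigr => u _.
    rewrite (exchange_big_dep (fun e => (e \in H) && (u \in e))) /=.
      by apply: eq_bigr => e /andP[eH ue]; apply: eq_bigl => v; rewrite eH ue.
    by move=> v e _ /andP[-> /andP[]].
  rewrite (exchange_big_dep (mem H)) /=; last by move=> ? ? _ /andP[].
  apply: eq_bigr => e eH; rewrite expr2 mulr_suml mulr_sumr eH.
  by apply: eq_bigr => u _; rewrite mulr_sumr mulr_sumr.
rewrite /normalized_laplacian mulmxBr mulmx1 mulmxBl !mulmxA scaleE.
rewrite -mulmxA scaleE'.
have subE (X Y : 'M[R]_1) : (X - Y) 0 0 = X 0 0 - Y 0 0 by rewrite !mxE.
rewrite adjE mulmxBr mulmxBl !subE degree_scaled_sqnorm pKp.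
have -> : (p *m diag_mx (\row_i (deg (enum_val i) / m)) *m p^T) 0 0 =
    \sum_(e in H) w e * \sum_(v in e) (phi v ^+ 2 / m).
  rewrite -sum_wdegree mxE -sum_enum_val; apply: eq_bigr => i _.
  by rewrite mul_mx_diag !mxE; ring.
rewrite -!sumrB; apply: eq_bigr => e _; rewrite -mulr_suml /m.
by field.
Qed.

End Laplacian.

(** * Test functions constant on groups of disjoint blocks *)

Section DisjointBlocks.
Variables (R : realType) (T : finType) (m : nat) (B : 'I_m -> {set T}).
Hypothesis Bdis : forall i j, i != j -> [disjoint B i & B j]%B.

Definition blockwise (c : 'I_m -> R) (v : T) : R := \sum_i c i * (v \in B i)%:R.

Lemma blockwise_in c i v : v \in B i -> blockwise c v = c i.
Proof.
move=> vBi; rewrite /blockwise (bigD1 i) //= vBi mulr1 big1 ?addr0 // => j ji.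
by rewrite (disjointFl (Bdis ji) vBi) mulr0.
Qed.

(** At most one term of [blockwise c v] is nonzero, so squaring acts on the
    coefficients. *)
Lemma blockwise_sqr c v : blockwise c v ^+ 2 = blockwise (fun i => c i ^+ 2) v.
Proof.
have [i vBi|vB] := pickP (fun i => v \in B i).
  by rewrite !(blockwise_in _ vBi).
by rewrite /blockwise !big1 ?expr0n // => i _; rewrite vB mulr0.
Qed.

End DisjointBlocks.

Section KthEigenvalue.
Variables (R : realType) (d : nat) (T : finType).
Variables (E : {set d.-tuple T}) (q : d.-tuple T -> R).
Hypotheses (Esym : symmetric_support E) (End : non_diagonal E).
Hypothesis (qsym : symmetric_coef E q).
Hypothesis d_ge2 : (2 <= d)%N.
Hypothesis deg_gt0 : forall v, 0 < wdegree E q v.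
Variables (m : nat) (B : 'I_m -> {set T}).
Hypothesis Bdis : forall i j, i != j -> [disjoint B i & B j]%B.

Local Notation inside t i := (all (fun v => v \in B i) t).

Lemma sum_sigma2 (c : 'I_m -> R) :
  \sum_i c i * sigma2 E q (B i) =
  d`!%:R * \sum_(t in E) q t ^+ 2 * \sum_i c i * (inside t i)%:R.
Proof.
under [in RHS]eq_bigr do rewrite mulr_sumr.
rewrite exchange_big mulr_sumr; apply: eq_bigr => i _ /=.
rewrite /sigma2 big_mkcondr !mulr_sumr; apply: eq_bigr => t tE.
by case: (all _ _); rewrite ?(mulr1, mulr0) //; ring.
Qed.

(** A tuple inside [B i] has all of its [d] vertices there. *)
Lemma sum_blockwise_ge (c : 'I_m -> R) (t : d.-tuple T) : t \in E ->
  (forall i, 0 <= c i) ->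
  d%:R * \sum_i c i * (inside t i)%:R <=
    \sum_(v in [set v in t]) blockwise B c v.
Proof.
move=> tE c0; rewrite exchange_big /= mulr_sumr; apply: ler_sum => i _.
rewrite -mulr_sumr mulrCA ler_wpM2l //.
case: (boolP (all _ _)) => [/allP tB|_]; last by rewrite mulr0 sumr_ge0.
rewrite mulr1 (eq_bigr (fun=> 1)); last by move=> v; rewrite inE => /tB ->.
by rewrite sumr_const (card_hyperedge End (imset_f _ tE)).
Qed.

(** Disjointness leaves at most one block around [t], because [t] is nonempty. *)
Lemma sum_inside (t : d.-tuple T) i : inside t i ->
  \sum_j 1 * (inside t j)%:R = 1 :> R.
Proof.
move=> ti; rewrite (bigD1 i) //= ti mulr1 big1 ?addr0 // => j ji; rewrite mul1r.
case: (boolP (all _ _)) => // /allP tj.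
have vt : tnth t (Ordinal (ltnW d_ge2)) \in t by rewrite mem_tnth.
by have := disjointFl (Bdis ji) (allP ti _ vt); rewrite tj.
Qed.

(** The factor [1 - sum_i 1_(t inside B_i)] is the indicator of the tuples inside
    no block.  If [t] is inside a block, the function is constant on it and the
    left-hand side is zero; otherwise drop the subtracted square. *)
Lemma edge_energy_le (c : 'I_m -> R) (M : R) (t : d.-tuple T) : t \in E ->
  0 <= M -> (forall i, c i ^+ 2 <= M) ->
  d%:R * \sum_(v in [set v in t]) blockwise B c v ^+ 2 -
    (\sum_(v in [set v in t]) blockwise B c v) ^+ 2 <=
  d%:R ^+ 2 * M * (1 - \sum_i 1 * (inside t i)%:R).
Proof.
move=> tE M0 cM.
have cardt :=
  card_hyperedge End (imset_f (fun t : d.-tuple T => [set v in t]) tE).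
have [i ti|tB] := pickP (fun i => inside t i).
  have tBi v : v \in [set v in t] -> v \in B i by rewrite inE; apply: (allP ti).
  rewrite (sum_inside ti) subrr mulr0.
  under eq_bigr => v /tBi vB do rewrite (blockwise_in Bdis _ vB).
  under [X in _ - X ^+ 2]eq_bigr => v /tBi vB
    do rewrite (blockwise_in Bdis _ vB).
  rewrite !sumr_const cardt -(mulr_natl (c i ^+ 2)) -(mulr_natl (c i)).
  by rewrite exprMn mulrA -expr2 subrr.
rewrite [\sum_i 1 * _]big1 => [|i _]; last by rewrite tB mulr0.
rewrite subr0 mulr1 lerBlDr ler_wpDr ?sqr_ge0 // expr2 -mulrA ler_wpM2l //.
apply: le_trans (_ : \sum_(v in [set v in t]) M <= _); last first.
  by rewrite sumr_const cardt mulr_natl.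
apply: ler_sum => v _; have [i vBi|vB] := pickP (fun i => v \in B i).
  by rewrite (blockwise_in Bdis _ vBi).
by rewrite /blockwise big1 ?expr0n // => i _; rewrite vB mulr0.
Qed.

(** The test space is spanned by [D^(1/2) 1_(S_j)], where [S_j] is the union of
    the blocks of group [j].  Both quadratic forms at the vector with
    coordinates [a] are compared with [|a|^2]: the squared norm is at least
    [d h |a|^2 / d!^2] and the energy at most
    [d^2 / (d - 1) |a|^2 spill / d!^2], where [spill] is [d!] times the weight
    of the tuples inside no block. *)
Lemma kth_eigenvalue_le_spill k (f : 'I_m -> 'I_k) (s : seq R) (h : R) :
  (0 < k)%N -> ordered_eigenvalues (normalized_laplacian E q) s -> 0 < h ->
  (forall j, h <= \sum_(i | f i == j) sigma2 E q (B i)) ->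
  nth 0 s k.-1 <= d%:R / (d%:R - 1) *
    ((d`!%:R * sqnorm_coef E q - \sum_i sigma2 E q (B i)) / h).
Proof.
move=> k_gt0 [ssort sE] h0 hf.
have d1 : 0 < d%:R - 1 :> R by rewrite subr_gt0 ltr1n.
have fact0 : 0 < d`!%:R :> R by rewrite ltr0n fact_gt0.
pose F : 'M[R]_(k, #|T|) := \matrix_(j, u)
  (Num.sqrt (wdegree E q (enum_val u)) *
   blockwise B (fun i => (f i == j)%:R) (enum_val u)).
pose phi (a : 'rV[R]_k) := blockwise B (fun i => a 0 (f i)).
have FE a : a *m F = degree_scaled E q (phi a).
  apply/rowP => u; rewrite !mxE.
  under eq_bigr => j _ do rewrite mxE mulrCA.
  rewrite -mulr_sumr; congr (_ * _); rewrite /phi /blockwise.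
  under eq_bigr => j _ do rewrite mulr_sumr.
  rewrite exchange_big; apply: eq_bigr => i _ /=.
  rewrite (bigD1 (f i)) //= eqxx mul1r big1 ?addr0 // => j.
  by rewrite eq_sym => /negPf ->; rewrite mul0r mulr0.
pose nrm (a : 'rV[R]_k) := \sum_j a 0 j ^+ 2.
have normF a : d%:R * h * nrm a <= d`!%:R ^+ 2 * ((a *m F) *m (a *m F)^T) 0 0.
  rewrite FE degree_scaled_sqnorm // [d`!%:R ^+ 2]expr2.
  rewrite -(mulrA d`!%:R d`!%:R) sum_hyperedges //.
  apply: le_trans (_ : d%:R * \sum_i a 0 (f i) ^+ 2 * sigma2 E q (B i) <= _).
    rewrite -mulrA ler_wpM2l // /nrm mulr_sumr (partition_big f predT) //=.
    apply: ler_sum => j _; rewrite mulrC.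
    rewrite (eq_bigr (fun i => a 0 j ^+ 2 * sigma2 E q (B i))); last first.
      by move=> i /eqP->.
    by rewrite -mulr_sumr ler_wpM2l // sqr_ge0.
  rewrite sum_sigma2 mulrCA ler_wpM2l ?(ltW fact0) // mulr_sumr.
  apply: ler_sum => t tE.
  rewrite mulrCA ler_wpM2l ?sqr_ge0 //.
  under [leRHS]eq_bigr => v _ do rewrite /phi blockwise_sqr //.
  by apply: sum_blockwise_ge => // i; rewrite sqr_ge0.
pose spill := d`!%:R * sqnorm_coef E q - \sum_i sigma2 E q (B i).
have spillE : spill = d`!%:R * \sum_(t in E) q t ^+ 2 *
    (1 - \sum_i 1 * (inside t i)%:R).
  rewrite /spill (eq_bigr (fun i => 1 * sigma2 E q (B i))); last first.
    by move=> *; rewrite mul1r.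
  rewrite sum_sigma2 -mulrBr -sumrB; congr (_ * _); apply: eq_bigr => t _.
  by rewrite mulrBr mulr1.
have energyF a : d`!%:R ^+ 2 *
    ((a *m F) *m normalized_laplacian E q *m (a *m F)^T) 0 0 <=
    d%:R ^+ 2 / (d%:R - 1) * nrm a * spill.
  rewrite FE degree_scaled_laplacian // [d`!%:R ^+ 2]expr2.
  rewrite -(mulrA d`!%:R d`!%:R) sum_hyperedges //.
  rewrite spillE mulrCA ler_wpM2l ?(ltW fact0) // mulr_sumr; apply: ler_sum => t tE.
  rewrite [leRHS]mulrCA ler_wpM2l ?sqr_ge0 //.
  have nrm_ge i : a 0 (f i) ^+ 2 <= nrm a.
    by rewrite /nrm (bigD1 (f i)) //= lerDl sumr_ge0 // => j _; rewrite sqr_ge0.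
  have nrm0 : 0 <= nrm a by rewrite sumr_ge0 // => j _; rewrite sqr_ge0.
  rewrite ler_pdivrMr //; apply: le_trans (edge_energy_le tE nrm0 nrm_ge) _.
  rewrite le_eqVlt; apply/orP; left; apply/eqP.
  by field; rewrite gt_eqF.
have norm_pos (a : 'rV_k) : a != 0 -> 0 < ((a *m F) *m (a *m F)^T) 0 0.
  move=> a0; have nrm_gt0 : 0 < nrm a.
    have /rV0Pn[j aj] := a0.
    rewrite /nrm (bigD1 j) //=; apply: ltr_pwDl; last first.
      by rewrite sumr_ge0 // => ? _; rewrite sqr_ge0.
    by rewrite lt_neqAle sqr_ge0 eq_sym sqrf_eq0 aj.
  have : 0 < d%:R * h * nrm a by rewrite !mulr_gt0 // ltr0n ltnW.
  by move=> /lt_le_trans/(_ (normF a)); rewrite pmulr_rgt0 // exprn_gt0.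
apply: kth_eigenvalue_le_rayleigh k_gt0 (normalized_laplacian_sym E q) ssort
  sE norm_pos _.
move=> a; have f2 : 0 < d`!%:R ^+ 2 :> R by rewrite exprn_gt0.
rewrite -(ler_pM2l f2); apply: le_trans (energyF a) _.
have spill0 : 0 <= spill.
  rewrite spillE mulr_ge0 ?(ltW fact0) // sumr_ge0 // => t _.
  rewrite mulr_ge0 ?sqr_ge0 //.
  have [i ti|tB] := pickP (fun i => inside t i).
    by rewrite (sum_inside ti) subrr.
  by rewrite big1 ?subr0 // => i _; rewrite tB mulr0.
have -> : d%:R ^+ 2 / (d%:R - 1) * nrm a * spill =
   d%:R / (d%:R - 1) * (spill / h) * (d%:R * h * nrm a).
  by field; rewrite !gt_eqF.
rewrite [leRHS]mulrCA; apply: ler_wpM2l (normF a).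
by rewrite mulr_ge0 ?divr_ge0 // ltW.
Qed.

End KthEigenvalue.

(** * Irreducibility *)

Unset Implicit Arguments.
Local Open Scope classical_set_scope.
Local Open Scope ring_scope.

Lemma limn_einf_gt0_near (R : realType) (u : nat -> R) :
  (0 < limn_einf (fun n => (u n)%:E))%E ->
  exists2 delta : R, 0 < delta & \forall n \near \oo, delta <= u n.
Proof.
rewrite limn_einf_lim.
rewrite (cvg_lim (@ereal_hausdorff R) (@cvg_einfs_sup R (fun n => (u n)%:E))).
move=> /ereal_sup_gt[_ [N _ <-]] lt0.
have le_u n : (N <= n)%N -> (einfs (fun n => (u n)%:E) N <= (u n)%:E)%E.
  by move=> Nn; apply: ereal_inf_lbound; exists n.
case: (einfs _ N) lt0 le_u => [r|_ /(_ N (leqnn N))|//]; last first.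
  by rewrite leNgt ltry.
rewrite lte_fin => r0 le_u; exists r => //.
by exists N => // n /= Nn; rewrite -lee_fin; apply: le_u.
Qed.

Theorem theorem5p7 (R : realType) (dO : measure_display)
    (Omega : measurableType dO) (P : probability Omega R) (U : choiceType)
    (d : nat) (d_ge2 : (2 <= d)%N) (Z : homogeneous_sums P U d)
    (deg_gt0 : forall (n : nat) (v : hs_V Z n),
       0 < wdegree (hs_E Z n) (hs_q Z n) v)
    (mu : forall n : nat, seq R)
    (mu_spec : forall n : nat, ordered_eigenvalues (hs_laplacian Z n) (mu n)) :
  (exists2 k : nat, (2 <= k)%N &
     (0 < limn_einf (fun n : nat => (nth 0%R (mu n) k.-1)%:E))%E) ->
  irreducible Z.
Proof.
case=> -[//|k] _ /limn_einf_gt0_near[delta delta0 mu_ge].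
case=> m [B [/= Bdis _ sum1 max0]].
pose K : R := k.+1%:R.
have K0 : 0 < K by rewrite ltr0n.
(* Groups reach at least the proportion c = 1/(4(k+1)) of the total; with blocks
   of proportion below c, this only needs a sum of 2c(k+1) = 1/2. *)
pose c : R := (4 * K)^-1.
have c0 : 0 < c by rewrite invr_gt0 mulr_gt0.
(* A spilled proportion below eta bounds the eigenvalue by
   2 * eta / c <= delta / 2. *)
pose eta : R := Num.min (1 / 2) (delta / (16 * K)).
have eta0 : 0 < eta by rewrite lt_min !divr_gt0 ?mulr_gt0.
have [n [mun sumn maxn]] : exists n, [/\ delta <= nth 0 (mu n) k.+1.-1,
    1 - (d`!%:R * sqnorm_coef (hs_E Z n) (hs_q Z n))^-1 *
      (\sum_(i < m n) sigma2 (hs_E Z n) (hs_q Z n) (B n i)) < eta &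
    (d`!%:R * sqnorm_coef (hs_E Z n) (hs_q Z n))^-1 *
      \big[Num.max/0]_(i < m n) sigma2 (hs_E Z n) (hs_q Z n) (B n i) < c].
  near \oo => n; exists n; split.
  - by near: n.
  - near: n; have /cvgrPdist_lt/(_ _ eta0) := sum1.
    by apply: filterS => n; apply: le_lt_trans; rewrite ler_norm.
  - near: n; have /cvgrPdist_lt/(_ _ c0) := max0.
    apply: filterS => n; rewrite sub0r normrN.
    by apply: le_lt_trans; rewrite ler_norm.
set tot := _ * sqnorm_coef _ _ in sumn maxn.
set s2 := sigma2 _ _ in sumn maxn.
have eta_half : eta <= 1 / 2 by rewrite ge_min lexx.
have sum_half : 1 / 2 <= tot^-1 * \sum_(i < m n) s2 (B n i) by lra.
have tot_gt0 : 0 < tot.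
  rewrite lt_neqAle mulr_ge0 ?sumr_ge0 // => [|t _]; last exact: sqr_ge0.
  rewrite andbT eq_sym; apply/eqP => tot0.
  by move: sum_half; rewrite tot0 invr0 mul0r; lra.
have [f fP] : exists f : 'I_(m n) -> 'I_k.+1,
    forall j, c <= \sum_(i | f i == j) tot^-1 * s2 (B n i).
  apply: (@exists_balanced_grouping _ _ _ c c) => [||i|]; try exact: ltW.
    apply: le_trans (ltW maxn); apply: ler_wpM2l; first by rewrite invr_ge0 ltW.
    exact: (le_bigmax _ (fun i => s2 (B n i))).
  rewrite -mulr_sumr; apply: le_trans sum_half.
  by rewrite /c -/K le_eqVlt; apply/orP; left; apply/eqP; field; rewrite gt_eqF.
have tc0 : 0 < tot * c by rewrite mulr_gt0.
have groups j : tot * c <= \sum_(i | f i == j) s2 (B n i).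
  by rewrite -ler_pdivlMl // mulr_sumr.
have := kth_eigenvalue_le_spill (@hs_E_sym _ _ _ _ _ _ Z n)
  (@hs_E_nondiag _ _ _ _ _ _ Z n)
  (@hs_q_sym _ _ _ _ _ _ Z n) d_ge2
  (deg_gt0 n) (Bdis n) (ltn0Sn k) (mu_spec n) tc0 groups.
rewrite -/tot -/s2 => mu_le.
have d2 : 2 <= d%:R :> R by rewrite ler_nat.
have spillE : (tot - \sum_i s2 (B n i)) / (tot * c) =
    4 * K * (1 - tot^-1 * \sum_i s2 (B n i)).
  by rewrite /c; field; rewrite !gt_eqF.
have spill_lt : (tot - \sum_i s2 (B n i)) / (tot * c) < delta / 4.
  rewrite spillE mulrC -ltr_pdivlMr ?mulr_gt0 //; apply: lt_le_trans sumn _.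
  have -> : delta / 4 / (4 * K) = delta / (16 * K) by field; rewrite gt_eqF.
  by rewrite ge_min lexx orbT.
have ratio_le : d%:R / (d%:R - 1) <= 2 :> R by rewrite ler_pdivrMr; lra.
have ratio_gt0 : 0 < d%:R / (d%:R - 1) :> R by rewrite divr_gt0; lra.
nra.
Unshelve. all: by end_near. Qed.
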